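(* Let $t_0\in\mathbb{R}$, let $b:[t_0,\infty)\to\mathbb{R}$ be continuous and let $k:[t_0,\infty)\to\mathbb{R}$ be differentiable. Suppose that there exists a constant $\alpha>0$ such that for all $t\ge t_0$ $$-k(t)\ge\alpha\qquad\text{and}\qquad k'(t)+2b(t)k(t)\ge 0.$$ Then the zero solution of $u''(t)+b(t)u'(t)+k(t)u(t)=0$ on $[t_0,\infty)$ is unstable.
   Context: The zero solution of the second-order equation is called stable if for each $\epsilon>0$ there exists $\delta=\delta(\epsilon,t_0)>0$ such that every solution $u$ on $[t_0,\infty)$ with $u(t_0)^2+u'(t_0)^2<\delta^2$ satisfies $u(t)^2+u'(t)^2<\epsilon^2$ for all $t\ge t_0$. It is called unstable if it is not stable. The initial time $t_0$ is fixed. *)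

(* Defs.v *)
(* Standard library real numbers. *)
From Stdlib Require Import Reals.
Local Open Scope R_scope.

(* Functions on [t0, +oo) are represented by total functions [R -> R] of which
   only the values on this set matter.  Relative to this domain, [continue_in]
   and [D_in] are one-sided at [t0] and two-sided elsewhere. *)
Definition halfline (t0 t : R) : Prop := t0 <= t.

Definition is_solution (t0 : R) (b k u du : R -> R) : Prop :=
  exists ddu : R -> R, forall t : R, t0 <= t ->
    D_in u du (halfline t0) t /\
    D_in du ddu (halfline t0) t /\
    ddu t + b t * du t + k t * u t = 0.

Definition zero_stable (t0 : R) (b k : R -> R) : Prop :=
  forall eps : R, 0 < eps ->
  exists delta : R, 0 < delta /\
    forall u du : R -> R, is_solution t0 b k u du ->
      u t0 ^ 2 + du t0 ^ 2 < delta ^ 2 ->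
      forall t : R, t0 <= t -> u t ^ 2 + du t ^ 2 < eps ^ 2.

Definition zero_unstable (t0 : R) (b k : R -> R) : Prop :=
  ~ zero_stable t0 b k.

(* Main.v *)
Require Import Defs.
From Stdlib Require Import Reals.
From Stdlib Require Import Lra Lia Factorial Ranalysis5 PSeries_reg IndefiniteDescription.
From Coquelicot Require Import Coquelicot.
Local Open Scope R_scope.

(** Along a solution, with [w = u'], the quantity [E = - w^2 / k - u^2] is
    nondecreasing: its derivative is [w^2 (k' + 2 b k) / k^2]
    ([energy_nondecreasing]).  Take [u t0 = 0] and [w t0 = d > 0].  Then
    [E t0 = d^2 / (- k t0)] is positive, and
    [w^2 = - k (E + u^2) >= alpha * E t0] for all later times.  So [w] is bounded
    away from zero, it keeps its initial sign by the intermediate value theorem,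
    and [u] grows at least linearly ([linear_growth]).  Since [d] can be taken
    arbitrarily small, no [delta] answers the challenge [eps = 1].

    Stability quantifies over solutions on the whole half-line, so it would hold
    vacuously if there were none with these initial values: refuting it requires
    a global existence result, [linear_ode_exists].  The coefficients are first
    extended continuously to the whole line.  The increments of the Picard
    iteration are then bounded by [C (M |t|)^n / n!] on each ball
    ([picard_bound]), so their series and the series of their derivatives
    converge uniformly on bounded sets, and the sum may be differentiated term
    by term ([derivable_pt_lim_SFL]). *)

(** * Series of functions with exponential majorants *)

(** The exponential series supplies the summable majorant: the iterates of a
    linear integral operator are bounded in this form on every ball. *)
Lemma CVN_R_exp_majorant (f : nat -> R -> R) :
  (forall r : R, 0 < r -> exists C M : R, 0 <= C /\ 0 <= M /\
     forall n y, Rabs y <= r ->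
       Rabs (f n y) <= C * (/ INR (fact n) * (M * r) ^ n)) ->
  CVN_R f.
Proof.
  intros H r.
  destruct (constructive_indefinite_description _ (H r (cond_pos r)))
    as [C HC].
  destruct (constructive_indefinite_description _ HC) as [M [C0 [M0 HM]]].
  exists (fun n => C * (/ INR (fact n) * (M * r) ^ n)).
  exists (C * exp (M * r)); split.
  - assert (E : is_series (fun n => Rabs (C * (/ INR (fact n) * (M * r) ^ n)))
                          (C * exp (M * r))).
    { apply is_series_ext with
        (fun n => scal C (/ INR (fact n) * (M * r) ^ n)).
      - intros n; symmetry; apply Rabs_pos_eq.
        apply Rmult_le_pos; [exact C0|apply Rmult_le_pos].
        + apply Rlt_le, Rinv_0_lt_compat, INR_fact_lt_0.
        + apply pow_le, Rmult_le_pos; [exact M0|apply Rlt_le, cond_pos].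
      - apply (is_series_scal C _ (exp (M * r))).
        apply is_series_ext with
          (fun n => scal (pow_n (M * r) n) (/ INR (fact n))).
        + intros n; rewrite pow_n_pow; apply Rmult_comm.
        + apply is_exp_Reals. }
    apply is_series_Reals in E; exact E.
  - intros n y Hy; apply HM.
    unfold Boule in Hy; rewrite Rminus_0_r in Hy; lra.
Qed.

Lemma SFL_cv (f : nat -> R -> R)
  (cf : forall x, {l : R | Un_cv (fun N => SP f N x) l}) (x : R) :
  Un_cv (fun N => SP f N x) (SFL f cf x).
Proof. unfold SFL; destruct (cf x) as [l Hl]; exact Hl. Qed.

(** Term-by-term differentiation, with the index shift of Picard iterates: the
    partial sum of order [N + 1] of [f] is a primitive of the partial sum of
    order [N] of [g]. *)
Lemma derivable_pt_lim_SFL (f g : nat -> R -> R) (a : R)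
  (cf : forall x, {l : R | Un_cv (fun N => SP f N x) l})
  (cg : forall x, {l : R | Un_cv (fun N => SP g N x) l}) :
  (forall x, f 0%nat x = a) ->
  (forall n x, derivable_pt_lim (f (S n)) x (g n x)) ->
  (forall n, continuity (g n)) ->
  CVN_R g ->
  forall x, derivable_pt_lim (SFL f cf) x (SFL g cg x).
Proof.
  intros f0 df cont cvn x.
  assert (Hr : 0 < Rabs x + 1) by (generalize (Rabs_pos x); lra).
  set (r := mkposreal _ Hr).
  apply (derivable_pt_lim_CVU (fun N => SP f (S N)) (fun N => SP g N)
           (SFL f cf) (SFL g cg) x 0 r).
  - unfold Boule; simpl; rewrite Rminus_0_r; lra.
  - intros y n _; induction n as [|n IH].
    + apply is_derive_Reals.
      apply is_derive_ext with (fun t => a + f 1%nat t).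
      * intros t; unfold SP; simpl; rewrite f0; reflexivity.
      * unfold SP; simpl; rewrite <- (Rplus_0_l (g 0%nat y)).
        apply (is_derive_plus (fun _ => a)).
        -- apply (is_derive_const a).
        -- apply is_derive_Reals, df.
    + apply (derivable_pt_lim_plus (SP f (S n)) (f (S (S n)))).
      * exact IH.
      * apply df.
  - intros y _ eps He.
    destruct (SFL_cv f cf y eps He) as [N HN].
    exists N; intros n Hn; apply HN; lia.
  - apply CVN_CVU, cvn.
  - intros y _; apply SFL_continuity; assumption.
Qed.

(** * Global solutions of a second-order linear equation *)

(** By the mean value theorem for [A t^(n+1)/(n+1) + f t] and
    [A t^(n+1)/(n+1) - f t], whose derivatives are nonnegative for
    [0 <= t <= r]. *)
Lemma primitive_pow_bound_right (f g : R -> R) (A r : R) (n : nat) :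
  f 0 = 0 ->
  (forall x, derivable_pt_lim f x (g x)) ->
  (forall x, Rabs x <= r -> Rabs (g x) <= A * Rabs x ^ n) ->
  forall t, 0 <= t <= r -> Rabs (f t) <= A / INR (S n) * t ^ S n.
Proof.
  intros f0 df bd t Ht.
  assert (HS : INR (S n) <> 0) by (apply not_0_INR; lia).
  (* The two signs [e] together bound the absolute value of [f t]. *)
  assert (side : forall e : R, e = 1 \/ e = -1 ->
            0 <= A / INR (S n) * t ^ S n + e * f t).
  { intros e He.
    set (h := fun x => A / INR (S n) * x ^ S n + e * f x).
    destruct (MVT_gen h 0 t (fun x => A * x ^ n + e * g x)) as [c [Hc E]].
    - intros x _; unfold h.
      apply (is_derive_plus (fun x => A / INR (S n) * x ^ S n)
                            (fun x => e * f x)).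
      + replace (A * x ^ n) with (A / INR (S n) * (INR (S n) * x ^ n))
          by (field; exact HS).
        apply (is_derive_scal (fun x => x ^ S n)).
        apply is_derive_Reals, (derivable_pt_lim_pow x (S n)).
      + apply (is_derive_scal f), is_derive_Reals, df.
    - intros x _; unfold h; apply derivable_continuous_pt.
      exists (A * x ^ n + e * g x).
      apply (derivable_pt_lim_plus (fun x => A / INR (S n) * x ^ S n)
                            (fun x => e * f x)).
      + replace (A * x ^ n) with (A / INR (S n) * (INR (S n) * x ^ n))
          by (field; exact HS).
        apply (derivable_pt_lim_scal (fun x => x ^ S n)).
        apply (derivable_pt_lim_pow x (S n)).
      + apply (derivable_pt_lim_scal f), df.
    - rewrite Rmin_left, Rmax_right in Hc by lra.
      unfold h in E; rewrite f0 in E.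
      assert (B : Rabs (g c) <= A * c ^ n).
      { rewrite <- (Rabs_pos_eq c) at 2 by lra.
        apply bd; rewrite Rabs_pos_eq; lra. }
      apply Rabs_le_between in B.
      rewrite (pow_i (S n)) in E by lia.
      assert (P : 0 <= (A * c ^ n + e * g c) * (t - 0)).
      { apply Rmult_le_pos; [|lra]. destruct He; subst e; lra. }
      lra. }
  apply Rabs_le.
  generalize (side 1 (or_introl eq_refl)) (side (-1) (or_intror eq_refl)).
  lra.
Qed.

Lemma primitive_pow_bound (f g : R -> R) (A r : R) (n : nat) :
  f 0 = 0 ->
  (forall x, derivable_pt_lim f x (g x)) ->
  (forall x, Rabs x <= r -> Rabs (g x) <= A * Rabs x ^ n) ->
  forall t, Rabs t <= r -> Rabs (f t) <= A / INR (S n) * Rabs t ^ S n.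
Proof.
  intros f0 df bd t Ht.
  destruct (Rle_or_lt 0 t) as [P|P].
  - rewrite (Rabs_pos_eq t) in * by lra.
    apply (primitive_pow_bound_right f g A r n); auto; lra.
  - rewrite (Rabs_left t) in * by lra.
    rewrite <- (Ropp_involutive t) at 1.
    apply (primitive_pow_bound_right (fun x => f (- x)) (fun x => - g (- x))
             A r n); try lra.
    + rewrite Ropp_0; exact f0.
    + intros x.
      replace (- g (- x)) with (g (- x) * (- 1)) by ring.
      apply (derivable_pt_lim_comp Ropp f).
      * apply (derivable_pt_lim_opp id), derivable_pt_lim_id.
      * apply df.
    + intros x Hx; rewrite Rabs_Ropp, <- (Rabs_Ropp x).
      apply bd; rewrite Rabs_Ropp; exact Hx.
Qed.

Lemma derivable_pt_lim_RInt (g : R -> R) (a x : R) :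
  continuity g -> derivable_pt_lim (fun t => RInt g a t) x (g x).
Proof.
  intros Hg; apply is_derive_Reals.
  apply (is_derive_RInt g (fun t => RInt g a t) a x).
  - apply filter_forall; intros t; apply (RInt_correct g).
    apply (ex_RInt_continuous g); intros z _.
    apply continuity_pt_filterlim, Hg.
  - apply continuity_pt_filterlim, Hg.
Qed.

Lemma continuity_bounded_ball (f : R -> R) (r : R) :
  continuity f -> 0 < r ->
  exists M, 0 <= M /\ forall x, Rabs x <= r -> Rabs (f x) <= M.
Proof.
  intros Hf Hr.
  destruct (continuity_ab_maj (fun x => Rabs (f x)) (- r) r) as [c [Hc _]].
  - lra.
  - intros c _; apply (continuity_pt_comp f Rabs); [apply Hf|apply Rcontinuity_abs].
  - exists (Rabs (f c)); split; [apply Rabs_pos|].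
    intros x Hx; apply Hc; apply Rabs_le_between; exact Hx.
Qed.

Section Picard.

Variables (b k : R -> R) (a d : R).
Hypotheses (cb : continuity b) (ck : continuity k).

(** Increments of Picard's successive approximations for the system
    [u' = w], [w' = - b w - k u], [u 0 = a], [w 0 = d]. *)
Fixpoint picard (n : nat) : (R -> R) * (R -> R) :=
  match n with
  | O => (fun _ => a, fun _ => d)
  | S m => (fun t => RInt (snd (picard m)) 0 t,
            fun t => RInt (fun s => - b s * snd (picard m) s
                                    + - k s * fst (picard m) s) 0 t)
  end.

Let pu n := fst (picard n).
Let pw n := snd (picard n).
Let pg n s := - b s * pw n s + - k s * pu n s.

Lemma continuity_rhs (u w : R -> R) :
  continuity u -> continuity w -> continuity (fun s => - b s * w s + - k s * u s).
Proof.
  intros Hu Hw.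
  apply (continuity_plus (fun s => - b s * w s) (fun s => - k s * u s)).
  - apply (continuity_mult (fun s => - b s) w); [|exact Hw].
    apply (continuity_opp b), cb.
  - apply (continuity_mult (fun s => - k s) u); [|exact Hu].
    apply (continuity_opp k), ck.
Qed.

Lemma picard_continuity n : continuity (pu n) /\ continuity (pw n).
Proof.
  unfold pu, pw; induction n as [|n [IHu IHw]]; simpl.
  - split; apply continuity_const; intros x y; reflexivity.
  - split; intros x; apply derivable_continuous_pt;
      eexists; apply derivable_pt_lim_RInt.
    + exact IHw.
    + apply continuity_rhs; assumption.
Qed.

Lemma picard_derivative n x :
  derivable_pt_lim (pu (S n)) x (pw n x) /\
  derivable_pt_lim (pw (S n)) x (pg n x).
Proof.
  destruct (picard_continuity n) as [Hu Hw]; split.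
  - apply derivable_pt_lim_RInt, Hw.
  - apply (derivable_pt_lim_RInt (pg n)), continuity_rhs; assumption.
Qed.

(** Each integration of [C M^n |t|^n / n!] produces the next such bound, with
    one factor [M] absorbing the coefficients. *)
Lemma picard_bound (r : R) : 0 < r ->
  exists C M, 0 <= C /\ 0 <= M /\
    forall n x, Rabs x <= r ->
      Rabs (pu n x) <= C * M ^ n / INR (fact n) * Rabs x ^ n /\
      Rabs (pw n x) <= C * M ^ n / INR (fact n) * Rabs x ^ n /\
      Rabs (pg n x) <= M * (C * M ^ n / INR (fact n) * Rabs x ^ n).
Proof.
  intros Hr.
  destruct (continuity_bounded_ball b r cb Hr) as [Mb [Mb0 HMb]].
  destruct (continuity_bounded_ball k r ck Hr) as [Mk [Mk0 HMk]].
  (* The summand 1 makes [M] dominate the coefficient of [u' = w] as well. *)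
  exists (Rabs a + Rabs d), (1 + Mb + Mk).
  set (C := Rabs a + Rabs d); set (M := 1 + Mb + Mk).
  assert (C0 : 0 <= C)
    by (unfold C; generalize (Rabs_pos a) (Rabs_pos d); lra).
  assert (M0 : 0 <= M) by (unfold M; lra).
  split; [exact C0|split; [exact M0|]].
  assert (Hg : forall n x, Rabs x <= r ->
    forall B, Rabs (pu n x) <= B -> Rabs (pw n x) <= B ->
      Rabs (pg n x) <= M * B).
  { intros n x Hx B Hu Hw; unfold pg.
    apply Rle_trans with (1 := Rabs_triang _ _).
    rewrite !Rabs_mult, !Rabs_Ropp.
    specialize (HMb x Hx); specialize (HMk x Hx).
    generalize (Rmult_le_compat _ _ _ _ (Rabs_pos _) (Rabs_pos _) HMb Hw)
               (Rmult_le_compat _ _ _ _ (Rabs_pos _) (Rabs_pos _) HMk Hu).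
    assert (0 <= B) by (apply Rle_trans with (2 := Hu), Rabs_pos).
    unfold M; lra. }
  induction n as [|n IH].
  - intros x Hx.
    assert (E : C * M ^ 0 / INR (fact 0) * Rabs x ^ 0 = C)
      by (simpl; field).
    rewrite E.
    assert (Hu : Rabs (pu 0 x) <= C)
      by (unfold C, pu; simpl; generalize (Rabs_pos d); lra).
    assert (Hw : Rabs (pw 0 x) <= C)
      by (unfold C, pw; simpl; generalize (Rabs_pos a); lra).
    split; [exact Hu|split; [exact Hw|apply Hg; assumption]].
  - assert (E : C * M ^ S n / INR (fact (S n))
                = M * (C * M ^ n / INR (fact n)) / INR (S n)).
    { rewrite fact_simpl, mult_INR; simpl pow; field; split.
      - apply INR_fact_neq_0.
      - apply not_0_INR; lia. }
    rewrite E; intros x Hx.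
    assert (Hu : Rabs (pu (S n) x)
      <= M * (C * M ^ n / INR (fact n)) / INR (S n) * Rabs x ^ S n).
    { apply (primitive_pow_bound (pu (S n)) (pw n) _ r n); [| | |exact Hx].
      - apply (RInt_point 0 (pw n)).
      - intros y; exact (proj1 (picard_derivative n y)).
      - intros y Hy; destruct (IH y Hy) as [_ [H _]].
        assert (0 <= C * M ^ n / INR (fact n) * Rabs y ^ n)
          by (apply Rle_trans with (2 := H), Rabs_pos).
        assert (1 <= M) by (unfold M; lra).
        nra. }
    assert (Hw : Rabs (pw (S n) x)
      <= M * (C * M ^ n / INR (fact n)) / INR (S n) * Rabs x ^ S n).
    { apply (primitive_pow_bound (pw (S n)) (pg n) _ r n); [| | |exact Hx].
      - apply (RInt_point 0 (pg n)).
      - intros y; exact (proj2 (picard_derivative n y)).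
      - intros y Hy; destruct (IH y Hy) as [_ [_ H]].
        rewrite Rmult_assoc; exact H. }
    split; [exact Hu|split; [exact Hw|apply Hg; assumption]].
Qed.

Lemma picard_CVN : CVN_R pu * CVN_R pw * CVN_R pg.
Proof.
  (* The three majorants differ by the factor [M] only, so [(1 + M) C] serves
     for all of them. *)
  assert (H : forall r, 0 < r -> exists C M, 0 <= C /\ 0 <= M /\
    forall n x, Rabs x <= r ->
      Rabs (pu n x) <= C * (/ INR (fact n) * (M * r) ^ n) /\
      Rabs (pw n x) <= C * (/ INR (fact n) * (M * r) ^ n) /\
      Rabs (pg n x) <= C * (/ INR (fact n) * (M * r) ^ n)).
  { intros r Hr; destruct (picard_bound r Hr) as [C [M [C0 [M0 H]]]].
    exists ((1 + M) * C), M; split; [|split; [exact M0|]].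
    { apply Rmult_le_pos; lra. }
    intros n x Hx; destruct (H n x Hx) as [Hu [Hw Hg]].
    set (B := C * M ^ n / INR (fact n) * Rabs x ^ n) in *.
    assert (B0 : 0 <= B) by (apply Rle_trans with (2 := Hu), Rabs_pos).
    assert (HB : B <= C * (/ INR (fact n) * (M * r) ^ n)).
    { replace (C * (/ INR (fact n) * (M * r) ^ n))
        with (C * M ^ n / INR (fact n) * r ^ n)
        by (rewrite Rpow_mult_distr; field; apply INR_fact_neq_0).
      apply Rmult_le_compat_l.
      - apply Rdiv_le_0_compat; [|apply INR_fact_lt_0].
        apply Rmult_le_pos; [exact C0|apply pow_le; exact M0].
      - apply pow_incr; split; [apply Rabs_pos|exact Hx]. }
    rewrite Rmult_assoc.
    set (D := C * (/ INR (fact n) * (M * r) ^ n)) in *.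
    repeat split; nra. }
  split; [split|]; apply CVN_R_exp_majorant; intros r Hr;
    destruct (H r Hr) as [C [M [C0 [M0 HM]]]]; exists C, M;
    (split; [exact C0|split; [exact M0|intros n y Hy; apply HM, Hy]]).
Qed.

Lemma linear_ode_from_0 :
  exists u w : R -> R, u 0 = a /\ w 0 = d /\
    forall t, derivable_pt_lim u t (w t) /\
              derivable_pt_lim w t (- b t * w t + - k t * u t).
Proof.
  destruct picard_CVN as [[Nu Nw] Ng].
  set (cu := CVN_R_CVS pu Nu); set (cw := CVN_R_CVS pw Nw).
  set (cg := CVN_R_CVS pg Ng).
  assert (at0 : forall (f : nat -> R -> R) cf c, f 0%nat 0 = c ->
            (forall n, f (S n) 0 = 0) -> SFL f cf 0 = c).
  { intros f cf c f0 fS; apply UL_sequence with (1 := SFL_cv f cf 0).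
    intros eps He; exists 0%nat; intros n _.
    replace (SP f n 0) with c; [rewrite Rdist_eq; exact He|].
    induction n as [|n IH]; unfold SP in *; simpl.
    - symmetry; exact f0.
    - rewrite <- IH, fS; ring. }
  exists (SFL pu cu), (SFL pw cw); split; [|split].
  - apply at0; [reflexivity|intros n; apply (RInt_point 0 (pw n))].
  - apply at0; [reflexivity|intros n; apply (RInt_point 0 (pg n))].
  - intros t; split.
    + apply derivable_pt_lim_SFL with (a := a); [reflexivity| | |exact Nw].
      * intros n x; exact (proj1 (picard_derivative n x)).
      * intros n; exact (proj2 (picard_continuity n)).
    + replace (- b t * SFL pw cw t + - k t * SFL pu cu t) with (SFL pg cg t).
      * apply derivable_pt_lim_SFL with (a := d); [reflexivity| | |exact Ng].
        -- intros n x; exact (proj2 (picard_derivative n x)).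
        -- intros n; apply continuity_rhs; apply picard_continuity.
      * apply UL_sequence with (1 := SFL_cv pg cg t).
        apply Un_cv_ext with
          (fun N => - b t * SP pw N t + - k t * SP pu N t).
        -- intros N; unfold SP, pg.
           rewrite !scal_sum, <- sum_plus.
           apply sum_eq; intros i _; ring.
        -- assert (cst : forall c, Un_cv (fun _ => c) c).
           { intros c eps He; exists 0%nat; intros n _.
             rewrite Rdist_eq; exact He. }
           apply (CV_plus (fun N => - b t * SP pw N t)
                          (fun N => - k t * SP pu N t));
             [apply (CV_mult (fun _ => - b t))|apply (CV_mult (fun _ => - k t))];
             try apply cst; apply SFL_cv.
Qed.

End Picard.

Lemma linear_ode_exists (b k : R -> R) (t0 a d : R) :
  continuity b -> continuity k ->
  exists u w : R -> R, u t0 = a /\ w t0 = d /\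
    forall t, derivable_pt_lim u t (w t) /\
              derivable_pt_lim w t (- b t * w t + - k t * u t).
Proof.
  intros cb ck.
  assert (shift : forall (f : R -> R) c, continuity f ->
            continuity (fun s => f (s + c))).
  { intros f c Hf s; apply (continuity_pt_comp (fun s => s + c) f); [|apply Hf].
    apply derivable_continuous_pt; eexists.
    apply (derivable_pt_lim_plus id (fun _ => c));
      [apply derivable_pt_lim_id|apply derivable_pt_lim_const]. }
  destruct (linear_ode_from_0 (fun s => b (s + t0)) (fun s => k (s + t0)) a d
              (shift b t0 cb) (shift k t0 ck)) as [u [w [u0 [w0 H]]]].
  exists (fun t => u (t - t0)), (fun t => w (t - t0)).
  rewrite Rminus_diag; split; [exact u0|split; [exact w0|]].
  assert (comp : forall (f : R -> R) l t, derivable_pt_lim f (t - t0) l ->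
            derivable_pt_lim (fun s => f (s - t0)) t l).
  { intros f l t Hf; replace l with (l * (1 - 0)) by ring.
    apply (derivable_pt_lim_comp (fun s => s - t0) f); [|exact Hf].
    apply (derivable_pt_lim_minus id (fun _ => t0));
      [apply derivable_pt_lim_id|apply derivable_pt_lim_const]. }
  intros t; destruct (H (t - t0)) as [H1 H2].
  replace (t - t0 + t0) with t in H2 by ring.
  split; apply comp; assumption.
Qed.

(** * Functions on a half-line *)

(** Freezing a function at its value in [t0] to the left of [t0] turns one-sided
    continuity at [t0] into continuity on the whole line. *)
Lemma continuity_extend_left (f : R -> R) (t0 : R) :
  (forall t, t0 <= t -> continue_in f (halfline t0) t) ->
  continuity (fun t => f (Rmax t0 t)).
Proof.
  intros Hf x eps He.
  destruct (Hf (Rmax t0 x) (Rmax_l t0 x) eps He) as [dl [Hd H]].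
  exists dl; split; [exact Hd|]; intros y [_ Hy].
  destruct (Req_dec (Rmax t0 y) (Rmax t0 x)) as [E|E].
  - rewrite E; simpl; rewrite Rdist_eq; exact He.
  - apply H; split.
    + split; [apply Rmax_l|apply not_eq_sym, E].
    + simpl in *; apply Rle_lt_trans with (2 := Hy); unfold Rdist.
      unfold Rmax; destruct (Rle_dec t0 y), (Rle_dec t0 x); split_Rabs; lra.
Qed.

Lemma D_in_of_derivable_pt_lim (f df : R -> R) (D : R -> Prop) (x : R) :
  derivable_pt_lim f x (df x) -> D_in f df D x.
Proof.
  intros H eps He; destruct (H eps He) as [dl Hd].
  exists dl; split; [apply cond_pos|].
  intros y [[_ Hne] Hy]; simpl in *; unfold Rdist in *.
  specialize (Hd (y - x)).
  replace (x + (y - x)) with y in Hd by ring.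
  apply Hd; [intros E; apply Hne; lra|exact Hy].
Qed.

Lemma derivable_pt_lim_of_D_in (f df : R -> R) (t0 x : R) :
  t0 < x -> D_in f df (halfline t0) x -> derivable_pt_lim f x (df x).
Proof.
  intros Hx H eps He; destruct (H eps He) as [dl [Hd Hl]].
  assert (P : 0 < Rmin dl (x - t0)) by (apply Rmin_pos; lra).
  exists (mkposreal _ P); simpl; intros h h0 Hh.
  assert (Hh1 := Rlt_le_trans _ _ _ Hh (Rmin_l _ _)).
  assert (Hh2 := Rlt_le_trans _ _ _ Hh (Rmin_r _ _)).
  specialize (Hl (x + h)); simpl in Hl; unfold Rdist in Hl.
  replace (x + h - x) with h in Hl by ring.
  apply Hl; split; [|exact Hh1].
  split; [unfold halfline; split_Rabs; lra|intros E; lra].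
Qed.

(** * Growth of the energy *)

Lemma continuity_pt_of_derivable_pt_lim (f : R -> R) (x l : R) :
  derivable_pt_lim f x l -> continuity_pt f x.
Proof. intros H; apply derivable_continuous_pt; exists l; exact H. Qed.

(** The terms in [u w] cancel in the derivative of [- w^2 / k - u^2], which
    leaves [w^2 (k' + 2 b k) / k^2].  The point [t0] is excluded from the
    differentiability of [k]: a left extension by a constant is in general not
    differentiable there. *)
Lemma energy_nondecreasing (t0 : R) (b k dk u w : R -> R) :
  continuity k ->
  (forall t, t0 <= t -> k t < 0) ->
  (forall t, t0 < t -> derivable_pt_lim k t (dk t)) ->
  (forall t, t0 <= t -> dk t + 2 * b t * k t >= 0) ->
  (forall t, t0 <= t -> derivable_pt_lim u t (w t)) ->
  (forall t, t0 <= t -> derivable_pt_lim w t (- b t * w t + - k t * u t)) ->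
  forall t, t0 <= t ->
    - w t0 ^ 2 / k t0 - u t0 ^ 2 <= - w t ^ 2 / k t - u t ^ 2.
Proof.
  intros ck kneg hk hsign hu hw t Ht.
  set (E := fun s => - w s ^ 2 / k s - u s ^ 2).
  destruct (MVT_gen E t0 t
    (fun s => w s ^ 2 * (dk s + 2 * b s * k s) / k s ^ 2)) as [c [Hc Hmvt]];
    rewrite ?Rmin_left, ?Rmax_right in * by lra.
  - intros s Hs; unfold E.
    assert (ks : k s <> 0) by (apply Rlt_not_eq, kneg; lra).
    assert (Dk : is_derive k s (dk s)) by (apply is_derive_Reals, hk; lra).
    assert (Du : is_derive u s (w s)) by (apply is_derive_Reals, hu; lra).
    assert (Dw : is_derive w s (- b s * w s + - k s * u s))
      by (apply is_derive_Reals, hw; lra).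
    auto_derive.
    + repeat split; try exact ks; eexists; eassumption.
    + replace (Derive (fun x => k x) s) with (dk s)
        by (symmetry; apply (is_derive_unique k), Dk).
      replace (Derive (fun x => u x) s) with (w s)
        by (symmetry; apply (is_derive_unique u), Du).
      replace (Derive (fun x => w x) s) with (- b s * w s + - k s * u s)
        by (symmetry; apply (is_derive_unique w), Dw).
      field; exact ks.
  - intros s Hs; unfold E.
    assert (cu : continuity_pt u s)
      by (apply (continuity_pt_of_derivable_pt_lim u s (w s)), hu; lra).
    assert (cw : continuity_pt w s)
      by (eapply continuity_pt_of_derivable_pt_lim, hw; lra).
    assert (sq : forall f, continuity_pt f s -> continuity_pt (fun x => f x ^ 2) s).
    { intros f cf; apply (continuity_pt_comp f (fun x => x ^ 2)); [exact cf|].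
      apply derivable_continuous_pt, derivable_pt_pow. }
    apply (continuity_pt_minus (fun x => - w x ^ 2 / k x) (fun x => u x ^ 2)).
    + apply (continuity_pt_div (fun x => - w x ^ 2) k).
      * apply (continuity_pt_opp (fun x => w x ^ 2)), sq, cw.
      * apply ck.
      * apply Rlt_not_eq, kneg; lra.
    + apply sq, cu.
  - fold (E t0) (E t).
    assert (kc : k c < 0) by (apply kneg; lra).
    assert (P : 0 <= w c ^ 2 * (dk c + 2 * b c * k c) / k c ^ 2).
    { apply Rdiv_le_0_compat; [|apply pow2_gt_0; lra].
      apply Rmult_le_pos; [apply pow2_ge_0|apply Rge_le, hsign; lra]. }
    assert (0 <= E t - E t0) by (rewrite Hmvt; apply Rmult_le_pos; lra).
    lra.
Qed.

(** A continuous [w] that is never zero cannot change sign, so the bound on its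
    square is a lower bound on [w] itself, to be integrated. *)
Lemma linear_growth (t0 c : R) (u w : R -> R) :
  0 < c -> 0 < w t0 ->
  continuity w ->
  (forall t, t0 <= t -> derivable_pt_lim u t (w t)) ->
  (forall t, t0 <= t -> c ^ 2 <= w t ^ 2) ->
  forall t, t0 <= t -> u t0 + c * (t - t0) <= u t.
Proof.
  intros c0 w0 cw hu hc t Ht.
  assert (wc : forall s, t0 <= s -> c <= w s).
  { intros s Hs; destruct (Rle_or_lt 0 (w s)) as [P|P].
    - specialize (hc s Hs); nra.
    - exfalso; destruct (Req_dec t0 s) as [<-|ne]; [lra|].
      destruct (IVT (fun x => - w x) t0 s) as [z [Hz wz]]; try lra.
      + apply (continuity_opp w), cw.
      + assert (w z = 0) by lra.
        specialize (hc z (proj1 Hz)); nra. }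
  destruct (MVT_gen u t0 t w) as [z [Hz E]];
    rewrite ?Rmin_left, ?Rmax_right in * by lra.
  - intros s Hs; apply is_derive_Reals, hu; lra.
  - intros s Hs.
    apply (continuity_pt_of_derivable_pt_lim u s (w s)), hu; lra.
  - specialize (wc z (proj1 Hz)); nra.
Qed.

Theorem theorem4p2 (t0 : R) (b k dk : R -> R)
  (hb : forall t : R, t0 <= t -> continue_in b (halfline t0) t)
  (hk : forall t : R, t0 <= t -> D_in k dk (halfline t0) t)
  (h : exists alpha : R, 0 < alpha /\
         forall t : R, t0 <= t ->
           - k t >= alpha /\ dk t + 2 * b t * k t >= 0) :
  zero_unstable t0 b k.
Proof.
  destruct h as [alpha [alpha0 h]]; intros stable.
  destruct (stable 1 Rlt_0_1) as [delta [delta0 small]].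
  set (be := fun t => b (Rmax t0 t)); set (ke := fun t => k (Rmax t0 t)).
  assert (bE : forall t, t0 <= t -> be t = b t)
    by (intros t Ht; unfold be; rewrite Rmax_right; auto).
  assert (kE : forall t, t0 <= t -> ke t = k t)
    by (intros t Ht; unfold ke; rewrite Rmax_right; auto).
  assert (cb : continuity be) by (apply continuity_extend_left, hb).
  assert (ck : continuity ke).
  { apply continuity_extend_left; intros t Ht.
    apply cont_deriv with dk, hk, Ht. }
  destruct (linear_ode_exists be ke t0 0 (delta / 2) cb ck)
    as [u [w [u0 [w0 ode]]]].
  assert (sol : is_solution t0 b k u w).
  { exists (fun t => - be t * w t + - ke t * u t); intros t Ht.
    destruct (ode t) as [Hu Hw].
    split; [|split]; try (apply D_in_of_derivable_pt_lim; assumption).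
    rewrite bE, kE by exact Ht; ring. }
  assert (kneg : forall t, t0 <= t -> ke t < 0)
    by (intros t Ht; rewrite kE by exact Ht; destruct (h t Ht); lra).
  assert (energy := energy_nondecreasing t0 be ke dk u w ck kneg).
  set (E0 := - w t0 ^ 2 / ke t0 - u t0 ^ 2) in *.
  assert (E0pos : 0 < E0).
  { unfold E0; rewrite u0, w0.
    replace (- (delta / 2) ^ 2 / ke t0 - 0 ^ 2)
      with ((delta / 2) ^ 2 / - ke t0)
      by (field; apply Rlt_not_eq, kneg, Rle_refl).
    apply Rdiv_lt_0_compat; [apply pow_lt; lra|].
    generalize (kneg t0 (Rle_refl t0)); lra. }
  assert (energy' : forall t, t0 <= t -> E0 <= - w t ^ 2 / ke t - u t ^ 2).
  { apply energy.
    - intros t Ht; apply derivable_pt_lim_of_D_in with (1 := Ht).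
      (* Near [t > t0] the extension coincides with [k]. *)
      intros eps He; destruct (hk t (Rlt_le _ _ Ht) eps He) as [dl [Hd Hl]].
      exists dl; split; [exact Hd|]; intros s [[Hs ne] Hy].
      rewrite !kE by (try exact Hs; lra).
      apply Hl; split; [split; assumption|exact Hy].
    - intros t Ht; rewrite bE, kE by exact Ht; apply h, Ht.
    - intros t _; apply ode.
    - intros t _; apply ode. }
  set (c := sqrt (alpha * E0)).
  assert (aE : 0 < alpha * E0) by (apply Rmult_lt_0_compat; lra).
  assert (c0 : 0 < c) by (apply sqrt_lt_R0, aE).
  assert (grow := linear_growth t0 c u w c0).
  (* After time [1 / c] linear growth with slope [c] has carried [u] to [1]. *)
  assert (u1 : 1 <= u (t0 + / c)).
  { replace 1 with (u t0 + c * (t0 + / c - t0)) by (rewrite u0; field; lra).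
    apply grow.
    - rewrite w0; lra.
    - intros t; eapply continuity_pt_of_derivable_pt_lim, ode.
    - intros t _; apply ode.
    - intros t Ht; unfold c; rewrite pow2_sqrt by lra.
      specialize (energy' t Ht); specialize (kneg t Ht).
      assert (ak : alpha <= - ke t)
        by (rewrite kE by exact Ht; destruct (h t Ht); lra).
      assert (wE : w t ^ 2 = - ke t * (- w t ^ 2 / ke t)) by (field; lra).
      rewrite wE; apply Rmult_le_compat; try lra.
      generalize (pow2_ge_0 (u t)); lra.
    - generalize (Rinv_0_lt_compat c c0); lra. }
  assert (bd : u (t0 + / c) ^ 2 + w (t0 + / c) ^ 2 < 1 ^ 2).
  { apply small.
    - exact sol.
    - rewrite u0, w0; nra.
    - generalize (Rinv_0_lt_compat c c0); lra. }
  generalize (pow2_ge_0 (w (t0 + / c))); nra.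
Qed.
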